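(* Let $V$ be a valuation domain with quotient field $K$ and valuation $v$, let $\overline{K}$ be an algebraic closure of $K$, and let $U$ be a fixed extension of $V$ to $\overline{K}$, with valuation $u$. Let $(\alpha,\delta),(\alpha',\delta')\in\overline{K}\times\Gamma_{\overline{v}}$. Then the following are equivalent: (1) $U_{\alpha,\delta}\cap K(X)=U_{\alpha',\delta'}\cap K(X)$; (2) $\sigma(U_{\alpha,\delta})=U_{\alpha',\delta'}$ for some $\sigma\in\mathcal{D}(U)$; (3) $\delta=\delta'$ and $u(\sigma(\alpha)-\alpha')\ge\delta$ for some $\sigma\in\mathcal{D}(U)$. In particular, for the residually transcendental extension $W=U_{\alpha,\delta}\cap K(X)$ of $V$ to $K(X)$, the set of extensions of $W$ to $\overline{K}(X)$ lying above $U$ equals $\{U_{\sigma(\alpha),\delta}:\sigma\in\mathcal{D}(U)\}$.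
   Context: $\Gamma_v$ is the value group of $v$ and $\Gamma_{\overline{v}}=\Gamma_v\otimes_{\mathbb{Z}}\mathbb{Q}$ its divisible hull (which is the value group of $u$). For $(\alpha,\delta)\in\overline{K}\times\Gamma_{\overline{v}}$, the monomial valuation $u_{\alpha,\delta}$ on $\overline{K}(X)$ is defined on polynomials by $u_{\alpha,\delta}\big(\sum_{i}a_i(X-\alpha)^i\big)=\min_i\{u(a_i)+i\delta\}$ ($a_i\in\overline{K}$) and extended to $\overline{K}(X)$; $U_{\alpha,\delta}$ is its valuation domain. $G_K=\mathrm{Gal}(\overline{K}/K)$ acts on $\overline{K}(X)$ via coefficients, and $\mathcal{D}(U)=\{\sigma\in G_K:\sigma(U)=U\}$ is the decomposition group of $U$. An extension $W$ of $V$ to $K(X)$ (a valuation domain of $K(X)$ with $W\cap K=V$) is residually transcendental if its residue field is transcendental over that of $V$. *)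

(* Defs.v *)
From HB Require Import structures.
From mathcomp Require Import all_boot all_order all_algebra fraction.
Set Implicit Arguments. Unset Strict Implicit. Unset Printing Implicit Defensive.
Import Order.TTheory GRing.Theory Num.Theory.
Local Open Scope ring_scope.

Notation "x %:F" := (@FracField.tofrac _ x) : ring_scope.

Definition valuation_ring (F : fieldType) (A : F -> Prop) : Prop :=
  [/\ A 1, (forall x y, A x -> A y -> A (x - y)),
      (forall x y, A x -> A y -> A (x * y)) &
      (forall x, x != 0 -> A x \/ A x^-1)].

(* Order on values of the valuation u attached to the valuation ring U:
   vle U x y  <->  u(x) <= u(y)   (with u(0) = +oo). *)
Definition vle (F : fieldType) (U : F -> Prop) (x y : F) : Prop :=
  y = 0 \/ (x != 0 /\ U (y / x)).

(* The coefficients a_i of p in the expansion p = \sum_i a_i (X - alpha)^i *)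
Definition shift_coef (F : fieldType) (alpha : F) (p : {poly F}) (i : nat) : F :=
  (p \Po ('X + alpha%:P))`_i.

(* Value delta in Gamma_u is represented by an element d != 0, delta = u(d);
   the i-th term value u(a_i) + i*delta is the value u(a_i * d^i). *)
Definition mono_term (F : fieldType) (alpha d : F) (p : {poly F}) (i : nat) : F :=
  shift_coef alpha p i * d ^+ i.

(* mono_ge U alpha d p q  <->  u_{alpha,delta}(q) <= u_{alpha,delta}(p),
   i.e.  min_j (u(b_j) + j delta) <= min_i (u(a_i) + i delta):
   some term of q has value below all terms of p. *)
Definition mono_ge (F : fieldType) (U : F -> Prop) (alpha d : F)
  (p q : {poly F}) : Prop :=
  exists j, forall i, vle U (mono_term alpha d q j) (mono_term alpha d p i).

(* The valuation domain U_{alpha,delta} of the monomial valuation u_{alpha,delta}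
   on F(X) = {fraction {poly F}}, with delta = u(d):
   { f : u_{alpha,delta}(f) >= 0 }. *)
Definition U_mono (F : fieldType) (U : F -> Prop) (alpha d : F)
  (f : {fraction {poly F}}) : Prop :=
  exists p q : {poly F}, [/\ q != 0, f = p%:F / q%:F & mono_ge U alpha d p q].

Definition inKX (F : fieldType) (K : {pred F}) (f : {fraction {poly F}}) : Prop :=
  exists p q : {poly F},
    [/\ p \is a polyOver K, q \is a polyOver K, q != 0 & f = p%:F / q%:F].

Definition constF (F : fieldType) (a : F) : {fraction {poly F}} := (a%:P)%:F.

Definition frac_image (F : fieldType) (sigma : {rmorphism F -> F})
  (W : {fraction {poly F}} -> Prop) (f : {fraction {poly F}}) : Prop :=
  exists p q : {poly F},
    [/\ q != 0, W (p%:F / q%:F) & f = (map_poly sigma p)%:F / (map_poly sigma q)%:F].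

Definition in_GK (F : fieldType) (K : {pred F}) (sigma : {rmorphism F -> F}) : Prop :=
  bijective sigma /\ (forall x, x \in K -> sigma x = x).

Definition in_decomp (F : fieldType) (K : {pred F}) (U : F -> Prop)
  (sigma : {rmorphism F -> F}) : Prop :=
  in_GK K sigma /\ (forall y, (exists x, U x /\ sigma x = y) <-> U y).

(* Main.v *)
(** Everything rests on the conjugacy of the extensions of a valuation to a normal
    extension, applied to [Kbar(X) / K(X)], whose automorphisms are those of [Kbar / K].
    Given valuation rings [A] and [B] with the same trace on the base field, Zorn's lemma
    yields a maximal embedding [s] of an intermediate field with [s^-1(B)] inside [A].
    To extend [s] to one more element [x], let [x_k], [y_k] be the roots of the minimal
    polynomial of [x] and of its image under [s].  If no [x |-> y_k] were admissible, prime
    avoidance would give a [G(x)] which is integral at every place involved, a nonunit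
    of [A] at [x], and a unit of [B] at all the [y_k]; its norm contradicts the hypothesis on [s].
    Such an [s] has finite orbits, so the inclusion of valuation rings is an equality.
    The comparison of [U_{alpha,delta}] with [U_{alpha',delta'}] is Gauss's lemma after the
    substitution [X |-> d X + alpha], and [u o sigma = u] for [sigma] in the decomposition
    group because orbits are finite. *)
From HB Require Import structures.
From mathcomp Require Import all_boot all_order all_algebra fraction.
From mathcomp Require Import boolp classical_sets.
From mathcomp Require Import perm mpoly.
Require Import Defs.
Set Implicit Arguments. Unset Strict Implicit. Unset Printing Implicit Defensive.
Import GRing.Theory.
Local Open Scope ring_scope.

(** * Valuation rings *)

Section ValuationRing.
Variables (F : fieldType) (V : F -> Prop) (hV : valuation_ring V).

Lemma vr1 : V 1. Proof. by case: hV. Qed.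
Lemma vrB x y : V x -> V y -> V (x - y). Proof. by case: hV => _ + _ _; apply. Qed.
Lemma vrM x y : V x -> V y -> V (x * y). Proof. by case: hV => _ _ + _; apply. Qed.
Lemma vrVn x : x != 0 -> ~ V x -> V x^-1.
Proof. by case: hV => _ _ _ + x0 => /(_ _ x0)[]. Qed.
Lemma vr0 : V 0. Proof. by rewrite -(subrr 1); apply: vrB vr1 vr1. Qed.
Lemma vrN x : V x -> V (- x). Proof. by rewrite -sub0r; apply: vrB vr0. Qed.
Lemma vrD x y : V x -> V y -> V (x + y).
Proof. by move=> Vx /vrN Vy; rewrite -[y]opprK; apply: vrB. Qed.
Lemma vrX x n : V x -> V (x ^+ n).
Proof. by move=> Vx; elim: n => [|n IH]; rewrite ?expr0 ?exprS; [exact: vr1 | exact: vrM]. Qed.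
Lemma vr_sum (I : Type) (r : seq I) (P : pred I) (G : I -> F) :
  (forall i, P i -> V (G i)) -> V (\sum_(i <- r | P i) G i).
Proof. by move=> VG; apply: big_ind => //; [exact: vr0 | exact: vrD]. Qed.
Lemma vr_prod (I : eqType) (r : seq I) (G : I -> F) :
  (forall i, i \in r -> V (G i)) -> V (\prod_(i <- r) G i).
Proof.
move=> VG; rewrite big_seq; apply: big_ind => //; [exact: vr1 | exact: vrM].
Qed.

(** Membership in the maximal ideal. Its negation does not assert integrality: it says only that the
    value of [x] is at most 0, so elements outside [V] satisfy it as well. *)
Definition vr_nonunit x := x = 0 \/ ~ V x^-1.

Lemma nonunitPn x : ~ vr_nonunit x -> x != 0 /\ V x^-1.
Proof.
move=> nu; split; first by apply/eqP => x0; apply: nu; left.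
by apply: contrapT => nVx; apply: nu; right.
Qed.
Lemma unit_nonunitN x : x != 0 -> V x^-1 -> ~ vr_nonunit x.
Proof. by move=> /eqP x0 Vx []. Qed.
Lemma nonunit_vr x : vr_nonunit x -> V x.
Proof.
case=> [->|nVx]; first exact: vr0.
have [->|x0] := eqVneq x 0; first exact: vr0.
by apply: contrapT => /(vrVn x0).
Qed.
Lemma nonunit0 : vr_nonunit 0. Proof. by left. Qed.
Lemma nonunit1N : ~ vr_nonunit 1.
Proof. by apply: unit_nonunitN; rewrite ?oner_eq0 ?invr1 //; apply: vr1. Qed.
Lemma nonunitMl x y : V x -> vr_nonunit y -> vr_nonunit (x * y).
Proof.
move=> Vx nuy; apply: contrapT => /nonunitPn[].
rewrite mulf_eq0 negb_or invfM => /andP[x0 y0] Vxy.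
apply: (unit_nonunitN y0 _ nuy); by rewrite -[y^-1](mulVKf x0); apply: vrM.
Qed.
Lemma nonunitMr x y : vr_nonunit x -> V y -> vr_nonunit (x * y).
Proof. by rewrite mulrC => nux Vy; apply: nonunitMl. Qed.
Lemma nonunitD x y : vr_nonunit x -> vr_nonunit y -> vr_nonunit (x + y).
Proof.
move=> nux nuy.
have [->|y0] := eqVneq y 0; first by rewrite addr0.
have [->|x0] := eqVneq x 0; first by rewrite add0r.
case: (pselect (V (x / y))) => [Vxy|/vrVn].
  rewrite (_ : x + y = (x / y + 1) * y); last by rewrite mulrDl mul1r divfK.
  by apply: nonunitMl nuy; apply: vrD vr1.
rewrite mulf_neq0 ?invr_eq0 // invf_div => /(_ isT) Vyx.
rewrite (_ : x + y = (y / x + 1) * x); last by rewrite mulrDl mul1r divfK // addrC.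
by apply: nonunitMl nux; apply: vrD vr1.
Qed.
Lemma nonunitN x : vr_nonunit x -> vr_nonunit (- x).
Proof. by rewrite -mulN1r => ?; apply: nonunitMl => //; apply/vrN/vr1. Qed.
Lemma nonunitB x y : vr_nonunit x -> vr_nonunit y -> vr_nonunit (x - y).
Proof. by move=> nux /nonunitN; apply: nonunitD. Qed.
Lemma nonunit_sum (I : Type) (r : seq I) (P : pred I) (G : I -> F) :
  (forall i, P i -> vr_nonunit (G i)) -> vr_nonunit (\sum_(i <- r | P i) G i).
Proof. by move=> VG; apply: big_ind => //; [exact: nonunit0 | exact: nonunitD]. Qed.
Lemma unitM x y : ~ vr_nonunit x -> ~ vr_nonunit y -> ~ vr_nonunit (x * y).
Proof.
move=> /nonunitPn[x0 Vx] /nonunitPn[y0 Vy]; apply: unit_nonunitN.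
  by rewrite mulf_neq0.
by rewrite invfM; apply: vrM.
Qed.
Lemma unit_prod (I : eqType) (r : seq I) (G : I -> F) :
  (forall i, i \in r -> ~ vr_nonunit (G i)) -> ~ vr_nonunit (\prod_(i <- r) G i).
Proof.
move=> uG; rewrite big_seq; apply: (big_ind (fun x => ~ vr_nonunit x)) => //.
  exact: nonunit1N.
exact: unitM.
Qed.
Lemma nonunitVn x : ~ V x -> vr_nonunit x^-1.
Proof. by move=> nV; right; rewrite invrK. Qed.
Lemma unit_nonunitD x y : ~ vr_nonunit x -> vr_nonunit y -> ~ vr_nonunit (x + y).
Proof. by move=> ux nuy nuxy; apply: ux; rewrite -(addrK y x); apply: nonunitB. Qed.

End ValuationRing.

Lemma vr_int (F : fieldType) (V : F -> Prop) (hV : valuation_ring V) (m : int) : V m%:~R.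
Proof.
have Vn n : V n%:R.
  by elim: n => [|n IH]; [exact: vr0 | rewrite -natr1; apply: vrD => //; exact: vr1].
by case: m => n; rewrite ?NegzE ?mulrNz -pmulrn //; apply: vrN.
Qed.

Lemma intpoly_horner_vr (F : fieldType) (V : F -> Prop) (hV : valuation_ring V)
    (g : F) (q : {poly int}) :
  V g -> V (map_poly intr q).[g].
Proof.
move=> Vg; rewrite horner_coef; apply: (vr_sum hV) => i _.
by rewrite coef_map; apply: (vrM hV); [exact: vr_int | exact: vrX].
Qed.

(* The leading term dominates at an element outside the valuation ring. *)
Lemma monic_horner_dominant (F : fieldType) (V : F -> Prop) (hV : valuation_ring V)
    (g : F) (q : {poly int}) :
  q \is monic -> (2 < size q)%N -> ~ V g ->
  [/\ (map_poly intr q).[g] != 0, V (map_poly intr q).[g]^-1 &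
      V (g / (map_poly intr q).[g])].
Proof.
move=> qm szq nVg.
have g0 : g != 0 by apply/eqP => g0; apply: nVg; rewrite g0; apply: vr0.
have nuw : vr_nonunit V g^-1 := nonunitVn nVg.
have Vw := nonunit_vr hV nuw.
have {szq} [n szq] : exists n, size q = n.+3.
  by case: (size q) szq => [|[|[|n]]] // _; exists n.
(* [u] is [q] at [g] divided by [g ^+ n.+2], where [n.+2] is the degree of [q]: a polynomial in the
   nonunit [g^-1] with constant term 1. *)
pose u : F := \sum_(i < n.+2) (q`_i)%:~R * g^-1 ^+ (n.+2 - i) + 1.
have hE : (map_poly intr q).[g] = g ^+ n.+2 * u.
  rewrite (@horner_coef_wide _ n.+3); last first.
    by rewrite (leq_trans (size_poly _ _)) // szq.
  rewrite big_ord_recr /= mulrDr mulr1 mulr_sumr; congr (_ + _).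
    apply: eq_bigr => i _; rewrite coef_map /= mulrCA exprVn; congr (_ * _).
    rewrite -{2}(subnK (ltnW (ltn_ord i))) exprD mulrAC divff ?mul1r //.
    by rewrite expf_neq0.
  rewrite coef_map /=; move/monicP: qm; rewrite lead_coefE szq /= => ->.
  by rewrite mul1r.
have nu_u : ~ vr_nonunit V u.
  rewrite /u addrC; apply: (unit_nonunitD hV) (nonunit1N hV) _.
  apply: (nonunit_sum hV) => i _; apply: (nonunitMl hV).
    exact: vr_int.
  rewrite -(prednK (_ : (0 < n.+2 - i)%N)) ?subn_gt0 // exprS.
  by apply: (nonunitMr hV) => //; apply: vrX.
have [u0 Vu] := nonunitPn nu_u.
rewrite hE mulf_neq0 ?expf_neq0 // invfM -exprVn; split=> //.
  by apply: (vrM hV) => //; apply: vrX.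
by rewrite mulrA exprS mulVKf //; apply: (vrM hV) => //; apply: vrX.
Qed.

(** * Finitely many places: common denominators and prime avoidance *)

Section FiniteFamily.
Variables (R : comNzRingType) (F : fieldType) (I : finType).
Variables (e : I -> {rmorphism R -> F}) (V : I -> F -> Prop).
Hypothesis hV : forall i, valuation_ring (V i).
(** This makes all the [e i] share one kernel, modulo which [R] is a field; the [V i] thus pull back
    to valuation rings of a single field. *)
Hypothesis eV : forall G i, e i G != 0 -> exists H, forall j, e j H * e j G = 1.

Definition all_vr G := forall i, V i (e i G).
Local Notation nu i G := (vr_nonunit (V i) (e i G)).

(** [H] is the inverse of [h] at [G] for a monic integer polynomial [h] whose value is a unit
    wherever [G] is integral, and dominates [G] at the other places. *)
Lemma common_denominator (a : I) G :
  exists H, [/\ all_vr H, all_vr (H * G) & forall b, V b (e b G) -> ~ nu b H].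
Proof.
pose ev (q : {poly int}) i := (map_poly intr q).[e i G].
have evM q1 q2 i : ev (q1 * q2) i = ev q1 i * ev q2 i by rewrite /ev rmorphM hornerM.
(* [Q] collects one factor for each place where the residue of [G] is a root of a monic integer
   polynomial. At any other place where [G] is integral, every monic polynomial takes a unit
   value. *)
have [Q [Qm QP]] : exists Q : {poly int}, Q \is monic /\
    forall i, i \in enum I -> V i (e i G) -> vr_nonunit (V i) (ev Q i) \/
       forall q, q \is monic -> ~ vr_nonunit (V i) (ev q i).
  elim: (enum I) => [|i s [Q [Qm QP]]]; first by exists 1; rewrite monic1.
  case: (pselect (exists2 q, q \is monic & vr_nonunit (V i) (ev q i))) => [[q qm nuq]|nq].
    exists (Q * q); split=> [|j]; first by rewrite monicMl.
    rewrite inE => /orP[/eqP->|js] VG.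
      by left; rewrite evM; apply: nonunitMl => //; apply: intpoly_horner_vr.
    case: (QP j js VG) => [nuQ|]; [left|by right].
    by rewrite evM; apply: nonunitMr => //; apply: intpoly_horner_vr.
  exists Q; split=> // j; rewrite inE => /orP[/eqP->|js] VG; last exact: QP.
  by right=> q qm nuq; apply: nq; exists q.
(* Where [Q] takes a nonunit value, [h] is 1 modulo the maximal ideal. The factor ['X^2] provides
   the degree that [monic_horner_dominant] requires. *)
pose h : {poly int} := 'X^2 * Q + 1.
have szXQ : (2 < size ('X^2 * Q)%R)%N.
  by rewrite -commr_polyXn size_mulXn ?monic_neq0 // !ltnS lt0n size_poly_eq0 monic_neq0.
have szh : size h = size ('X^2 * Q).
  by rewrite size_polyDl // size_poly1 ltnW.
have hm : h \is monic.
  by rewrite monicE lead_coefDl ?size_poly1 1?ltnW // -monicE monicMl // monicXn.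
have hu i : V i (e i G) -> ~ vr_nonunit (V i) (ev h i).
  move=> VG; case: (QP i (mem_enum _ _) VG) => [nuQ|]; last exact.
  rewrite /ev rmorphD rmorph1 hornerD hornerC addrC -/(ev _ _).
  apply: unit_nonunitD => //; first exact: nonunit1N.
  by rewrite evM; apply: nonunitMl => //; apply: intpoly_horner_vr.
have hn i : ~ V i (e i G) -> _ := monic_horner_dominant (hV i) hm (leq_trans szXQ (eq_leq (esym szh))).
pose hG := (map_poly intr h).[G].
have ehG i : e i hG = ev h i.
  rewrite -horner_map -map_poly_comp; congr (_.[_]).
  by apply: eq_map_poly => z /=; rewrite rmorph_int.
have h0 : e a hG != 0.
  rewrite ehG; case: (pselect (V a (e a G))) => [/hu/nonunitPn[]//|/hn[]//].
have [H HP] := eV h0.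
have HE i : e i H = (ev h i)^-1.
  have h1 := HP i; rewrite ehG in h1.
  have hi0 : ev h i != 0 by apply: contra_eq_neq h1 => ->; rewrite mulr0 eq_sym oner_eq0.
  by rewrite -[LHS](mulfK hi0) h1 mul1r.
exists H; split=> [i|i|i VG].
- by rewrite HE; case: (pselect (V i (e i G))) => [/hu/nonunitPn[]//|/hn[]//].
- rewrite rmorphM HE mulrC.
  case: (pselect (V i (e i G))) => [VG|/hn[]//].
  by apply: vrM => //; have [] := nonunitPn (hu i VG).
- rewrite HE; apply: unit_nonunitN; first by rewrite invr_eq0; have [] := nonunitPn (hu i VG).
  by rewrite invrK; apply: intpoly_horner_vr.
Qed.

(** If [G] were integral at [b] but not at [a], its denominator [H], equal to [H * G] times the
    inverse of [G], would be a nonunit at [a] but not at [b]. *)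
Lemma vr_sub_of_center_sub a b :
  (forall G, all_vr G -> nu a G -> nu b G) -> forall G, V b (e b G) -> V a (e a G).
Proof.
move=> ab G VbG; apply: contrapT => nVaG.
have [H [HV HGV Hb]] := common_denominator a G.
apply: (Hb b VbG); apply: ab => //.
have G0 : e a G != 0 by apply/eqP => G0; apply: nVaG; rewrite G0; apply: vr0.
rewrite -[e a H](mulfK G0) -rmorphM; apply: nonunitMl => //.
exact: nonunitVn.
Qed.

Lemma prime_avoidance a (J : seq I) :
  (forall b, b \in J -> exists G, [/\ all_vr G, nu a G & ~ nu b G]) ->
  exists G, [/\ all_vr G, nu a G & forall b, b \in J -> ~ nu b G].
Proof.
have vr_add G H : all_vr G -> all_vr H -> all_vr (G + H).
  by move=> VG VH i; rewrite rmorphD; apply: vrD.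
have av n : forall J : seq I, uniq J -> size J = n ->
    (forall b, b \in J -> exists G, [/\ all_vr G, nu a G & ~ nu b G]) ->
    exists G, [/\ all_vr G, nu a G & forall b, b \in J -> ~ nu b G].
  elim: n => [|n IH] {}J uJ sJ hJ.
  move/size0nil: sJ => ->; exists 0; split=> [i||b //].
    by rewrite rmorph0; apply: vr0.
  by rewrite rmorph0; apply: nonunit0.
(* The induction hypothesis for [J] without [b] gives an element that can fail only at [b]. The
   implication lets [choice] produce a function on all of [I]. *)
have {IH} cP b : exists G, b \in J ->
    [/\ all_vr G, nu a G & forall c, c \in J -> c != b -> ~ nu c G].
  case bJ: (b \in J); last by exists 0.
  have [||b'|G [VG aG G']] := IH (rem b J).
  - exact: rem_uniq.
  - by rewrite size_rem // sJ.
  - by move/mem_rem/hJ.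
  by exists G => _; split=> // c cJ cb; apply: G'; rewrite mem_rem_uniq // inE cb.
have [c {}cP] := choice cP.
case: (pselect (exists2 b, b \in J & ~ nu b (c b))) => [[b bJ nub]|allnu].
  have [Vc ac cc] := cP b bJ; exists (c b); split=> // b' b'J.
  by case: (eqVneq b' b) => [->|]; [|exact: cc].
have {}allnu b : b \in J -> nu b (c b).
  by move=> bJ; apply: contrapT => nub; apply: allnu; exists b.
case: J uJ sJ hJ cP allnu => [//|b1 [_ _ hJ _ _|b2 J]].
  have [G [VG aG bG]] := hJ b1 (mem_head _ _).
  by exists G; split=> // b; rewrite inE => /eqP->.
move=> uJ _ _ cP allnu; set J1 := b2 :: J in uJ cP allnu *.
have [Vc1 ac1 c1] := cP b1 (mem_head _ _).
have inJ b : b \in J1 -> b \in b1 :: J1 by move=> bJ; rewrite inE bJ orbT.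
have neq1 b : b \in J1 -> b != b1.
  by apply: contraTneq => ->; case/andP: uJ.
have VP : forall s : seq I, {subset s <= J1} -> all_vr (\prod_(b <- s) c b).
  move=> s sJ i; rewrite rmorph_prod; apply: vr_prod => // b /sJ/inJ bJ.
  by have [] := cP b bJ.
have nuP b i : b \in J1 -> nu i (c b) -> nu i (\prod_(b <- J1) c b).
  move=> bJ nub; rewrite (perm_big _ (perm_to_rem bJ)) big_cons rmorphM.
  by apply: nonunitMr => //; apply: VP => x /mem_rem.
(* Every [c b] is now a nonunit at its own [b]. At [b1] only the first summand is a nonunit, at each
   place of [J1] only the second, so the sum is a nonunit at none of them. *)
exists (c b1 + \prod_(b <- J1) c b); split.
- by apply: vr_add => //; apply: VP.
- rewrite rmorphD; apply: nonunitD => //.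
  apply: (nuP b2); first exact: mem_head.
  by have [] := cP b2 (inJ b2 (mem_head _ _)).
move=> b; rewrite inE => /orP[/eqP->|bJ].
  rewrite addrC rmorphD; apply: unit_nonunitD => //; last by apply/allnu/mem_head.
  rewrite rmorph_prod; apply: unit_prod => // b' b'J.
  have [_ _ ] := cP b' (inJ _ b'J); apply; first exact: mem_head.
  by rewrite eq_sym neq1.
rewrite rmorphD; apply: unit_nonunitD => //.
  by apply: c1; [exact: inJ | exact: neq1].
by apply: (nuP b) => //; apply/allnu/inJ.
  move=> hJ; have [|G [VG aG bG]] := av _ (undup J) (undup_uniq _) erefl.
    by move=> b; rewrite mem_undup; apply: hJ.
  by exists G; split=> // b bJ; apply: bG; rewrite mem_undup.
Qed.

End FiniteFamily.

(** * Norms *)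

Lemma mmap_comp_mpoly (n k : nat) (R S : comNzRingType) (phi : {rmorphism R -> S})
    (h : 'I_k -> S) (lq : n.-tuple {mpoly R[k]}) (p : {mpoly R[n]}) :
  mmap phi h (p \mPo lq) = mmap phi (fun i => mmap phi h (tnth lq i)) p.
Proof.
rewrite comp_mpolyE rmorph_sum /=; apply: eq_bigr => m _.
rewrite mmapZ rmorph_prod; congr (_ * _).
by apply: eq_bigr => i _; rewrite rmorphXn.
Qed.

Lemma mmap_mesym (n k : nat) (R S : comNzRingType) (phi : {rmorphism R -> S})
    (h : 'I_n -> S) :
  mmap phi h (mesym n R k) = (mesym n S k).@[h].
Proof.
rewrite !mesymE !rmorph_sum /=; apply: eq_bigr => s _.
by rewrite mmapX mevalX.
Qed.

(* [N] is the resultant of [f] and [G]. *)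
Lemma universal_norm (R : comNzRingType) (n : nat) (f G : {poly R}) :
  exists N : R, forall (L : idomainType) (phi : {rmorphism R -> L}) (zs : n.-tuple L),
    map_poly phi f = \prod_(z <- zs) ('X - z%:P) ->
    phi N = \prod_(z <- zs) (map_poly phi G).[z].
Proof.
(* The product of the values of [G] at indeterminate roots is symmetric, hence a polynomial [t] in
   the elementary symmetric functions. This yields [N] in [R] before any splitting is chosen, so
   that one [N] serves several embeddings. *)
pose P : {mpoly R[n]} := \prod_(i < n) (map_poly (@mpolyC n R) G).['X_i].
have mapC (S : nzRingType) (g : {rmorphism {mpoly R[n]} -> S}) i :
    g (map_poly (@mpolyC n R) G).['X_i] = (map_poly (g \o @mpolyC n R) G).[g 'X_i].
  by rewrite -horner_map -map_poly_comp.
have symP : P \is symmetric.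
  apply/issymP => s; rewrite /P rmorph_prod /= [RHS](reindex_inj (@perm_inj _ s)) /=.
  apply: eq_bigr => i _; rewrite mapC /= {2}/msym mmapX mmap1U; congr (_.[_]).
  by apply: eq_map_poly => c /=; rewrite /msym mmapC.
have [t [tP _]] := sym_fundamental symP.
(* By Vieta, the elementary symmetric function of degree [i.+1] of the roots is the signed
   coefficient of index [n - i.+1]; ordinals start at 0, whence the shift. *)
exists (t.@[fun i : 'I_n => (-1) ^+ i.+1 * f`_(n - i.+1)]) => L phi zs fE.
transitivity (mmap phi (tnth zs) P); last first.
  rewrite /P rmorph_prod /= big_tuple; apply: eq_bigr => i _.
  rewrite mapC /= mmapX mmap1U; congr (_.[_]).
  by apply: eq_map_poly => c /=; rewrite mmapC.
rewrite -tP mmap_comp_mpoly mevalE rmorph_sum /=; apply: eq_bigr => m _.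
rewrite rmorphM rmorph_prod; congr (_ * _); apply: eq_bigr => i _.
rewrite rmorphXn; congr (_ ^+ _).
rewrite tnth_mktuple mmap_mesym rmorphM rmorphXn rmorphN1 -coef_map fE.
by rewrite (mroots_coeff zs (lift ord0 i)) signrMK.
Qed.

(** * Conjugacy of valuation rings *)

Definition poly_eval (T L : fieldType) (phi : {rmorphism T -> L}) (z : L) :
  {rmorphism {poly T} -> L} := horner_eval z \o map_poly phi.

Lemma minimal_annihilator (T L : fieldType) (phi : {rmorphism T -> L}) (x : L) (p : {poly T}) :
  p != 0 -> poly_eval phi x p = 0 ->
  exists f : {poly T}, [/\ f \is monic, poly_eval phi x f = 0 &
    forall G, poly_eval phi x G = 0 -> f %| G].
Proof.
move=> p0 px.
have ex : exists n, `[< exists f : {poly T}, [/\ f != 0, size f = n & poly_eval phi x f = 0] >].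
  by exists (size p); apply/asboolP; exists p.
case: (ex_minnP ex) => n /asboolP[f [f0 szf fx]] nmin.
have lf0 : (lead_coef f)^-1 != 0 by rewrite invr_eq0 lead_coef_eq0.
exists ((lead_coef f)^-1 *: f); split.
- by rewrite monicE lead_coefZ mulVf // lead_coef_eq0.
- by rewrite -mul_polyC rmorphM fx mulr0.
move=> G Gx; rewrite dvdpZl // /dvdp; apply/negPn/negP => R0.
have := nmin (size (G %% f)); rewrite -szf leqNgt ltn_modp f0 => /implyP.
rewrite implybF => /negP; apply; apply/asboolP; exists (G %% f); split=> //.
by move: Gx; rewrite {1}(divp_eq G f) rmorphD rmorphM fx mulr0 add0r.
Qed.

(** In a factorization of [f] one factor vanishes at [x] and is therefore a multiple of [f]. So [f]
    is irreducible, the gcd with [G] is constant, and Bezout applies. *)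
Lemma minimal_annihilator_inverse (T L : fieldType) (phi : {rmorphism T -> L}) (x : L)
    (f G : {poly T}) :
  f \is monic -> poly_eval phi x f = 0 -> (forall G, poly_eval phi x G = 0 -> f %| G) ->
  ~~ (f %| G) -> exists u v, u * f + v * G = 1.
Proof.
move=> fm fx fmin nfG.
have f0 := monic_neq0 fm.
have cop : coprimep f G.
  have /dvdpP[q fE] := dvdp_gcdl f G.
  have : poly_eval phi x q * poly_eval phi x (gcdp f G) = 0 by rewrite -rmorphM -fE.
  move/eqP; rewrite mulf_eq0 => /orP[]/eqP/fmin.
    move=> /dvdp_leq le_fq; rewrite /coprimep.
    have q0 : q != 0 by apply: contra_neq f0 => q0; rewrite fE q0 mul0r.
    have g0 : gcdp f G != 0 by apply: contra_neq f0 => g0; rewrite fE g0 mulr0.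
    have := le_fq q0; rewrite {1}fE size_mul // -ltnS prednK; last first.
      by rewrite addn_gt0 size_poly_gt0 q0.
    by rewrite -addn1 leq_add2l => g1; rewrite eqn_leq g1 size_poly_gt0.
  by move=> /dvdp_trans/(_ (dvdp_gcdr _ _)); rewrite (negPf nfG).
by have [[u v] /= uv] := Bezout_eq1_coprimepP _ _ cop; exists u, v.
Qed.

Lemma map_dvdp_splits (T L : fieldType) (phi : {rmorphism T -> L}) (f p : {poly T}) (rs : seq L) :
  f \is monic -> f %| p -> map_poly phi p = \prod_(r <- rs) ('X - r%:P) ->
  exists zs : (size f).-1.-tuple L, map_poly phi f = \prod_(z <- zs) ('X - z%:P).
Proof.
move=> fm fp pE.
have : map_poly phi f %| \prod_(r <- rs) ('X - r%:P) by rewrite -pE dvdp_map.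
case/dvdp_prod_XsubC => m; rewrite eqp_monic ?map_monic ?monic_prod_XsubC // => /eqP fE.
have sz : size (mask m rs) == (size f).-1.
  by rewrite -(size_map_poly phi) fE size_prod_XsubC.
by exists (Tuple sz).
Qed.

(** One step of the extension of an embedding. The field generated by [x] over the image of [phi] is
    described through polynomials: equal kernels make the map from [x] to [y] well defined and
    injective, and the last clause keeps domination. *)
Lemma extend_to_root (T L : fieldType) (A B : L -> Prop)
    (hA : valuation_ring A) (hB : valuation_ring B) (phi psi : {rmorphism T -> L})
    (x : L) (p : {poly T}) (rs ss : seq L) :
  (forall t, B (psi t) -> A (phi t)) ->
  p != 0 -> poly_eval phi x p = 0 ->
  map_poly phi p = \prod_(r <- rs) ('X - r%:P) ->
  map_poly psi p = \prod_(r <- ss) ('X - r%:P) ->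
  exists y, forall G,
    (poly_eval phi x G = 0 <-> poly_eval psi y G = 0) /\
    (B (poly_eval psi y G) -> A (poly_eval phi x G)).
Proof.
move=> hAB p0 px phip psip.
have [f [fm fx fmin]] := minimal_annihilator p0 px.
have [xs xsE] := map_dvdp_splits fm (fmin _ px) phip.
have [ys ysE] := map_dvdp_splits fm (fmin _ px) psip.
set n := (size f).-1 in xs ys xsE ysE.
(* Left indices are the roots under [phi], with the ring [A]; right indices are the roots under
   [psi], with the ring [B]. *)
pose e (i : 'I_n + 'I_n) : {rmorphism {poly T} -> L} :=
  match i with inl k => poly_eval phi (tnth xs k) | inr k => poly_eval psi (tnth ys k) end.
pose V (i : 'I_n + 'I_n) := if i then A else B.
have hV i : valuation_ring (V i) by case: i.
have ef i : e i f = 0.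
  case: i => k; rewrite /= /horner_eval ?xsE ?ysE; apply/rootP; rewrite root_prod_XsubC; exact: mem_tnth.
have fdvd i G : f %| G -> e i G = 0.
  by case/dvdpP => q ->; rewrite rmorphM ef mulr0.
have inv G i : e i G != 0 -> exists H, forall j, e j H * e j G = 1.
  move=> Gi; have nfG : ~~ (f %| G) by apply: contra_neqN Gi => /(fdvd i).
  have [u [v uv]] := minimal_annihilator_inverse fm fx fmin nfG.
  by exists v => j; rewrite -rmorphM -(rmorph1 (e j)) -uv rmorphD [e j (u * f)]rmorphM ef mulr0 add0r.
have [k0 k0E] : exists k, tnth xs k = x.
  have /tnthP[k ->] : x \in xs by rewrite -root_prod_XsubC -xsE; apply/rootP.
  by exists k.
have fker i G : e i G = 0 -> f %| G.
  move=> Gi; apply: contraPT Gi => nfG Gi.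
  have [u [v uv]] := minimal_annihilator_inverse fm fx fmin nfG.
  have := congr1 (e i) uv; rewrite rmorphD !rmorphM ef Gi !mulr0 addr0 rmorph1.
  by move/eqP; rewrite eq_sym oner_eq0.
suff [k Hk] : exists k, forall G, all_vr e V G ->
    vr_nonunit A (e (inl k0) G) -> vr_nonunit B (e (inr k) G).
  have sub := vr_sub_of_center_sub hV inv (a := inl k0) (b := inr k) Hk.
  exists (tnth ys k) => G; split; last by rewrite -k0E; apply: sub.
  rewrite -k0E; split=> G0.
    by apply: (fdvd (inr k)); apply: (fker (inl k0)).
  by apply: (fdvd (inl k0)); apply: (fker (inr k)).
apply: contrapT => none.
have [|G [VG G0 Gk]] := @prime_avoidance _ _ _ e V hV (inl k0) [seq inr k | k <- enum 'I_n].
  move=> _ /mapP[k _ ->]; apply: contrapT => noG; apply: none; exists k => G VG G0.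
  by apply: contrapT => nGk; apply: noG; exists G.
(* [psi N] is a product of factors of value at most 0 for [B], so [N^-1] is sent into [B] by [psi],
   hence into [A] by [phi]. But [phi N] is a product of elements of [A], one of them a nonunit. *)
have [N NP] := universal_norm n f G.
have phiN := NP L phi xs xsE; have psiN := NP L psi ys ysE.
have : ~ vr_nonunit B (psi N).
  rewrite psiN; apply: (unit_prod hB) => _ /tnthP[k ->].
  by apply: (Gk (inr k)); rewrite map_f ?mem_enum.
case/nonunitPn; rewrite fmorph_eq0 -fmorphV => N0 /hAB; rewrite fmorphV => AN.
have : ~ vr_nonunit A (phi N) by apply: unit_nonunitN => //; rewrite fmorph_eq0.
apply; rewrite phiN big_tuple (bigD1 k0) //=.
apply: (nonunitMr hA) => //; rewrite -big_filter.
by apply: (vr_prod hA) => k _; apply: (VG (inl k)).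
Qed.

(** * Partial field embeddings and Zorn's lemma *)

Record subfield_of (L : fieldType) (E : divringClosed L) :=
  SubfieldOf { subfield_val :> L; _ : subfield_val \in E }.
HB.instance Definition _ (L : fieldType) (E : divringClosed L) :=
  [isSub for @subfield_val L E].
HB.instance Definition _ (L : fieldType) (E : divringClosed L) :=
  [Choice of subfield_of E by <:].
HB.instance Definition _ (L : fieldType) (E : divringClosed L) :=
  [SubChoice_isSubIntegralDomain of subfield_of E by <:].
HB.instance Definition _ (L : fieldType) (E : divringClosed L) :=
  [SubIntegralDomain_isSubField of subfield_of E by <:].

Section Conjugacy.
Variables (L : fieldType) (A B : L -> Prop).
Hypotheses (hA : valuation_ring A) (hB : valuation_ring B).
Variable F : {pred L}.

(* The graphs of the field embeddings [s], defined on an intermediate field of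
   [L] over [F], which fix [F] and satisfy [s^-1(B) <= A]. *)
Definition dominating_graph (S : set (L * L)) : Prop :=
  [/\ forall c, c \in F -> S (c, c),
      forall u v, S u -> S v -> S (u - v) /\ S (u * v),
      forall u, S u -> S (u.1^-1, u.2^-1),
      forall u, S u -> (u.1 = 0 <-> u.2 = 0) &
      forall u, S u -> B u.2 -> A u.1].

Lemma dominating_graph_inj S x y y' :
  dominating_graph S -> S (x, y) -> S (x, y') -> y = y'.
Proof.
case=> _ SBM _ S0 _ Sy Sy'; have [/S0[/= + _] _] := SBM _ _ Sy Sy'.
by rewrite subrr => /(_ erefl)/eqP; rewrite subr_eq0 => /eqP.
Qed.

(** Turns a partial embedding into two total morphisms from its domain [T], the inclusion and the
    embedding, which is the form that [extend_to_root] takes. *)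
Lemma dominating_graph_field (hF : divring_closed F) S : dominating_graph S ->
  exists (T : fieldType) (phi psi : {rmorphism T -> L}),
    forall x y, S (x, y) <-> exists t, x = phi t /\ y = psi t.
Proof.
move=> gS; have [SF SBM SV S0 SAB] := gS.
have S1 : S (1, 1) by apply: SF; case: hF.
pose E : {pred L} := fun x => `[< exists y, S (x, y) >].
have clE : divring_closed E.
  split=> [|x y /asboolP[x' Sx] /asboolP[y' Sy]|x y /asboolP[x' Sx] /asboolP[y' Sy]].
  - by apply/asboolP; exists 1.
  - by apply/asboolP; exists (x' - y'); case: (SBM _ _ Sx Sy).
  - by apply/asboolP; exists (x' / y'); case: (SBM _ _ Sx (SV _ Sy)).
pose E' : divringClosed L := HB.pack E (GRing.isDivringClosed.Build L E clE).
pose T := subfield_of E'.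
have psiE (t : T) : exists y, S (val t, y) by apply/asboolP/(valP t).
have [psi psiP] := choice psiE.
have psiB : zmod_morphism psi.
  move=> s t; apply: dominating_graph_inj gS (psiP _) _.
  by case: (SBM _ _ (psiP s) (psiP t)).
have psiM : monoid_morphism psi.
  split=> [|s t]; apply: dominating_graph_inj gS (psiP _) _ => //.
  by case: (SBM _ _ (psiP s) (psiP t)).
pose psi' : {rmorphism T -> L} := HB.pack psi
  (GRing.isZmodMorphism.Build T L psi psiB) (GRing.isMonoidMorphism.Build T L psi psiM).
exists T, val, psi' => x y; split=> [Sxy|[t [-> ->]]]; last exact: psiP.
have xE : x \in E' by apply/asboolP; exists y.
exists (Sub x xE); split=> //.
exact: dominating_graph_inj gS Sxy (psiP (Sub x xE)).
Qed.

Lemma dominating_graph_extend (hF : divring_closed F) S x (p : {poly L}) rs :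
  dominating_graph S -> p \is a polyOver F ->
  p = \prod_(r <- rs) ('X - r%:P) -> x \in rs ->
  exists S' y, [/\ dominating_graph S', (S `<=` S')%classic & S' (x, y)].
Proof.
move=> gS pF pE xrs; have [T [phi [psi SE]]] := dominating_graph_field hF gS.
have [SF SBM SV S0 SAB] := gS.
(* The coefficients of [p] lie in [F], which the graph fixes, so a single [q] over [T] is sent to
   [p] by both [phi] and [psi]. *)
have cE i : exists t, p`_i = phi t /\ p`_i = psi t.
  by apply/SE/SF; have /allP := pF; case: (ltnP i (size p)) => [szi|szi _];
    [apply; apply: mem_nth|rewrite nth_default //; have [F1 FB _] := hF; rewrite -(subrr 1) FB].
have [c cP] := choice cE.
pose q := \poly_(i < size p) c i.
have [phiq psiq] : map_poly phi q = p /\ map_poly psi q = p.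
  split; apply/polyP => i; rewrite coef_map coef_poly; have [cphi cpsi] := cP i;
    by case: ltnP => /= szi; [rewrite -?cphi -?cpsi | rewrite rmorph0 nth_default].
have q0 : q != 0.
  by rewrite -(map_poly_eq0 phi) phiq pE monic_neq0 ?monic_prod_XsubC.
have qx : poly_eval phi x q = 0.
  by apply/eqP; rewrite /= /horner_eval phiq pE; apply: etrans xrs; apply: root_prod_XsubC.
have SAB' t : B (psi t) -> A (phi t) by apply: (SAB (phi t, psi t)); apply/SE; exists t.
have [y yP] := extend_to_root hA hB SAB' q0 qx (etrans phiq pE) (etrans psiq pE).
have evC (f : {rmorphism T -> L}) z t : poly_eval f z t%:P = f t.
  by rewrite /= /horner_eval map_polyC hornerC.
have Sconst t : exists G, (phi t, psi t) = (poly_eval phi x G, poly_eval psi y G).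
  by exists t%:P; rewrite !evC.
have [f [fm fx fmin]] := minimal_annihilator q0 qx.
have fy : poly_eval psi y f = 0 by apply/(yP f).1.
(* The polynomial values at [x] already form a field: by Bezout with the minimal polynomial [f], a
   nonzero value has a polynomial inverse, the same one at [x] and at [y]. *)
exists [set u | exists G, u = (poly_eval phi x G, poly_eval psi y G)]%classic, y.
split; first split.
- by move=> a /SF/SE[t [at1 at2]]; rewrite {1}at1 at2; apply: Sconst.
- move=> _ _ [G ->] [H ->]; split; first by exists (G - H); rewrite !rmorphB.
  by exists (G * H); rewrite !rmorphM.
- move=> _ [G ->]; have [Gx|Gx] := eqVneq (poly_eval phi x G) 0.
    exists 0; rewrite !rmorph0; congr pair; apply/eqP; rewrite invr_eq0; apply/eqP => //.
    exact: (yP G).1.1 Gx.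
  have nfG : ~~ (f %| G).
    by apply: contra_neqN Gx => /dvdpP[r ->]; rewrite rmorphM fx mulr0.
  have [u [v uv]] := minimal_annihilator_inverse fm fx fmin nfG.
  have evV (g : {rmorphism {poly T} -> L}) : g f = 0 -> (g G)^-1 = g v.
    move=> gf; have := congr1 g uv; rewrite rmorphD !rmorphM gf mulr0 add0r rmorph1 => gvG.
    have G0 : g G != 0 by apply: contra_eq_neq gvG => ->; rewrite mulr0 eq_sym oner_eq0.
    by rewrite -[RHS](mulfK G0) gvG mul1r.
  by exists v; congr pair; apply: evV.
- by move=> _ [G ->]; apply: (yP G).1.
- by move=> _ [G ->]; apply: (yP G).2.
- by move=> [a b] /SE[t [-> ->]]; apply: Sconst.
- by exists 'X; rewrite /= /horner_eval !map_polyX !hornerX.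
Qed.

(** Split polynomials are asked for on a generating family [Gen] only. For the rational function
    field this family is the constants, whose polynomials split already over [Kbar]. *)
Theorem dominating_embedding (Gen : L -> Prop) (hF : divring_closed F) :
  (forall c, c \in F -> B c -> A c) ->
  (forall x, Gen x -> exists rs : seq L,
     \prod_(r <- rs) ('X - r%:P) \is a polyOver F /\ x \in rs) ->
  (forall E : {pred L}, divring_closed E -> {subset F <= E} ->
     (forall x, Gen x -> x \in E) -> forall z, z \in E) ->
  exists s : {rmorphism L -> L},
    (forall c, c \in F -> s c = c) /\ (forall z, B (s z) -> A z).
Proof.
move=> hAB hGen genE.
pose P S := (S = set0 \/ dominating_graph S)%classic.
have gD : dominating_graph [set u | u.1 = u.2 /\ u.1 \in F]%classic.
  have [F1 FB FD] := hF.
  have FV x : x \in F -> x^-1 \in F by move=> xF; rewrite -[x^-1]mul1r FD.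
  split=> //.
  - move=> [a a'] [b b'] [/= <- aF] [/= <- bF]; split; split=> //=; first exact: FB.
    by rewrite -[b]invrK; apply: FD => //; apply: FV.
  - by move=> [a a'] [/= <- aF]; split=> //; apply: FV.
  - by move=> [a a'] [/= <- _].
  - by move=> [a a'] [/= <- aF]; apply: hAB.
have [|S [PS Smax]] := @Zorn_bigcup _ P.
  move=> C CP Ctot.
  case: (pselect (exists S0, C S0 /\ dominating_graph S0)) => [[S0 [CS0 gS0]]|none]; last first.
    left; apply/seteqP; split=> // u [X CX Xu].
    by case: (CP X CX) => [X0|gX]; [rewrite -X0|case: none; exists X].
  have gC X u : C X -> X u -> dominating_graph X.
    by move=> CX Xu; case: (CP X CX) => // X0; rewrite X0 in Xu.
  right; split.
  - by move=> c cF; exists S0 => //; have [SF _ _ _ _] := gS0; apply: SF.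
  - move=> u v [X CX Xu] [Y CY Yv].
    have [Z [CZ Zu Zv]] : exists Z, [/\ C Z, Z u & Z v].
      by case: (Ctot X Y CX CY) => sub; [exists Y|exists X]; split=> //; apply: sub.
    have [_ ZBM _ _ _] := gC Z u CZ Zu.
    by have [ZB ZM] := ZBM u v Zu Zv; split; exists Z.
  - by move=> u [X CX Xu]; exists X => //; have [_ _ XV _ _] := gC X u CX Xu; apply: XV.
  - by move=> u [X CX Xu]; have [_ _ _ X0 _] := gC X u CX Xu; apply: X0.
  - by move=> u [X CX Xu]; have [_ _ _ _ XAB] := gC X u CX Xu; apply: XAB.
have gS : dominating_graph S.
  case: PS => // S0; case: (Smax _ _ (or_intror gD)); rewrite S0; split=> // sub.
  by apply: (sub (1, 1)); split=> //=; case: hF.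
(* The domain of a maximal graph is a field containing [F], and each generator by the one-step
   extension, so it is all of [L]. *)
have totS z : exists y, S (z, y).
  apply/asboolP; apply: (genE (fun z => `[< exists y, S (z, y) >])).
  - have [SF SBM SV _ _] := gS; split=> [|x y|x y].
    + by apply/asboolP; exists 1; apply: SF; case: hF.
    + move=> /asboolP[x' Sx] /asboolP[y' Sy]; apply/asboolP; exists (x' - y').
      by case: (SBM _ _ Sx Sy).
    + move=> /asboolP[x' Sx] /asboolP[y' Sy]; apply/asboolP; exists (x' / y').
      by case: (SBM _ _ Sx (SV _ Sy)).
  - by move=> c cF; apply/asboolP; exists c; have [SF _ _ _ _] := gS; apply: SF.
  move=> x /hGen[rs [rsF xrs]]; apply/asboolP.
  have [S' [y [gS' SS' S'x]]] := dominating_graph_extend hF gS rsF erefl xrs.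
  exists y; apply: contrapT => nS; apply: (Smax S' _ (or_intror gS')).
  by split=> // /(_ _ S'x).
have [s sP] := choice totS.
have [SF SBM _ _ SAB] := gS.
have sB : zmod_morphism s.
  move=> x y; apply: dominating_graph_inj gS (sP _) _.
  by case: (SBM _ _ (sP x) (sP y)).
have sM : monoid_morphism s.
  split=> [|x y]; apply: dominating_graph_inj gS (sP _) _ => //.
    by apply: SF; case: hF.
  by case: (SBM _ _ (sP x) (sP y)).
pose s' : {rmorphism L -> L} := HB.pack s
  (GRing.isZmodMorphism.Build L L s sB) (GRing.isMonoidMorphism.Build L L s sM).
exists s'; split=> [c cF|z] /=; first by apply: dominating_graph_inj gS (sP _) (SF c cF).
exact: (SAB (z, s z)).
Qed.

End Conjugacy.

(** * Gauss valuations *)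

Lemma frac_repr (R : idomainType) (f : {fraction R}) :
  exists p q : R, q != 0 /\ f = p%:F / q%:F.
Proof.
elim/quotW: f => x; exists (frac x).1, (frac x).2; split; first exact: denom_ratioP.
have d0 : (frac x).2%:F != 0 :> {fraction R} by rewrite tofrac_eq0 denom_ratioP.
apply: (mulIf d0); rewrite divfK //.
rewrite -[LHS]/(FracField.mul _ _) !piE; apply/eqmodP.
by rewrite /= FracField.equivfE /FracField.mulf !numden_Ratio ?mulf_neq0 ?oner_eq0 ?denom_ratioP // !mulr1 mulrC.
Qed.

(** This substitution carries the monomial valuation at [alpha], [d] to the Gauss valuation, the
    minimum of the values of the coefficients. *)
Definition affine_subst (F : fieldType) (alpha d : F) (p : {poly F}) : {poly F} :=
  p \Po (d *: 'X + alpha%:P).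

Section GaussValuation.
Variables (F : fieldType) (U : F -> Prop) (hU : valuation_ring U).

Lemma vleP (x y : F) : x != 0 -> vle U x y <-> U (y / x).
Proof.
move=> x0; split=> [[->|[]//]|Uyx]; last by right.
by rewrite mul0r; apply: vr0.
Qed.

Lemma vr_div_trans (c x y : F) : c != 0 -> U (x / c) -> U (c / y) -> U (x / y).
Proof.
move=> c0 Uxc Ucy; rewrite (_ : x / y = x / c * (c / y)); first exact: vrM.
by rewrite mulrA divfK.
Qed.

(** [c] represents the least value of a coefficient of [p]: no coefficient has smaller value, and
    some coefficient has value at most that of [c]. *)
Definition is_content (p : {poly F}) (c : F) : Prop :=
  [/\ c != 0, forall i, U (p`_i / c) & exists j, ~ vr_nonunit U (p`_j / c)].

Lemma content_exists p : p != 0 -> exists c, is_content p c.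
Proof.
move=> p0.
have [c [c0 cp Uc]] : exists c, [/\ c != 0, c \in polyseq p & forall a, a \in polyseq p -> U (a / c)].
  have : exists2 a, a \in polyseq p & a != 0.
    exists (lead_coef p); last by rewrite lead_coef_eq0.
    by rewrite lead_coefE mem_nth // prednK // size_poly_gt0.
  elim: (polyseq p) => [|a s IH] [b]; rewrite ?inE // => bs b0.
  case: (pselect (exists2 b, b \in s & b != 0)) => [/IH[c [c0 cs Uc]]|none].
    case: (pselect (U (a / c))) => [Uac|nUac].
      exists c; split=> // [|x]; first by rewrite inE cs orbT.
      by rewrite inE => /orP[/eqP->|/Uc].
    have a0 : a != 0 by apply/eqP => a0; apply: nUac; rewrite a0 mul0r; apply: vr0.
    have Uca : U (c / a) by rewrite -invf_div; apply: vrVn => //; rewrite mulf_neq0 ?invr_eq0.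
    exists a; split=> // [|x]; first exact: mem_head.
    rewrite inE => /orP[/eqP->|/Uc Uxc]; first by rewrite divff //; apply: vr1.
    exact: vr_div_trans Uxc Uca.
  have s0 x : x \in s -> x = 0.
    by move=> xs; apply/eqP/negPn/negP => x0; apply: none; exists x.
  have ba : b = a by case/orP: bs => [/eqP //|/s0 b00]; rewrite b00 eqxx in b0.
  rewrite {b bs}ba in b0; exists a; split=> // [|x]; first exact: mem_head.
  rewrite inE => /orP[/eqP->|/s0->]; first by rewrite divff //; apply: vr1.
  by rewrite mul0r; apply: vr0.
exists c; split=> // [i|].
  case: (ltnP i (size p)) => szi; first by apply/Uc/mem_nth.
  by rewrite nth_default // mul0r; apply: vr0.
exists (index c p); rewrite nth_index // divff //; exact: nonunit1N.
Qed.

Lemma coefM_div_vr (p q : {poly F}) c e :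
  (forall i, U (p`_i / c)) -> (forall i, U (q`_i / e)) -> forall i, U ((p * q)%R`_i / (c * e)).
Proof.
move=> Up Uq i; rewrite coefM mulr_suml; apply: vr_sum => // j _.
by rewrite invfM mulrACA; apply: vrM.
Qed.

(** Gauss's lemma. If [m] and [n] are the first indices where the two contents are attained, then in
    the coefficient of index [m + n] all terms but one are nonunits after division by [c * e]. *)
Lemma contentM p q c e : is_content p c -> is_content q e -> is_content (p * q) (c * e).
Proof.
move=> [c0 Up exp_] [e0 Uq exq]; split; [by rewrite mulf_neq0|exact: coefM_div_vr|].
have exP : exists j, ~~ `[< vr_nonunit U (p`_j / c) >] by case: exp_ => j jP; exists j; apply/asboolPn.
have exQ : exists j, ~~ `[< vr_nonunit U (q`_j / e) >] by case: exq => j jP; exists j; apply/asboolPn.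
case: (ex_minnP exP) => m /asboolPn pm mP; case: (ex_minnP exQ) => n /asboolPn qn nP.
have ltm j : (j < m)%N -> vr_nonunit U (p`_j / c).
  by move=> jm; apply: contrapT => /asboolPn/mP; rewrite leqNgt jm.
have ltn' j : (j < n)%N -> vr_nonunit U (q`_j / e).
  by move=> jn; apply: contrapT => /asboolPn/nP; rewrite leqNgt jn.
have lem : (m < (m + n).+1)%N by rewrite ltnS leq_addr.
exists (m + n)%N; rewrite coefM (bigD1 (Ordinal lem)) //= mulrDl addKn.
apply: unit_nonunitD => //.
  by rewrite invfM mulrACA; apply: unitM.
rewrite mulr_suml; apply: nonunit_sum => // j jm.
rewrite invfM mulrACA; case: (ltngtP j m) => jm'.
- by apply: nonunitMr => //; apply: ltm.
- apply: nonunitMl => //; apply: ltn'.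
  by rewrite ltn_subLR ?ltn_add2r // -ltnS.
- by move: jm; rewrite -val_eqE /= jm' eqxx.
Qed.

Lemma content_dvd p c x : is_content p c -> (forall i, U (p`_i / x)) -> x != 0 -> U (c / x).
Proof.
move=> [c0 _ [j /nonunitPn[pj Uj]]] Ux x0.
move: pj; rewrite mulf_eq0 invr_eq0 negb_or => /andP[pj0 _].
apply: (vr_div_trans pj0) => //.
by rewrite -invf_div.
Qed.

Lemma contentC c : c != 0 -> is_content c%:P c.
Proof.
move=> c0; split=> // [i|]; last first.
  by exists 0%N; rewrite coefC /= divff //; apply: nonunit1N.
by rewrite coefC; case: eqP => _; rewrite ?divff ?mul0r //; [apply: vr1|apply: vr0].
Qed.

Lemma affine_substM (alpha d : F) (p q : {poly F}) :
  affine_subst alpha d (p * q) = affine_subst alpha d p * affine_subst alpha d q.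
Proof. exact: rmorphM. Qed.

Lemma affine_substB (alpha d : F) (p q : {poly F}) :
  affine_subst alpha d (p - q) = affine_subst alpha d p - affine_subst alpha d q.
Proof. exact: rmorphB. Qed.

Lemma affine_subst0 (alpha d : F) : affine_subst alpha d 0 = 0.
Proof. exact: rmorph0. Qed.

Lemma affine_substC (alpha d c : F) : affine_subst alpha d c%:P = c%:P.
Proof. exact: comp_polyC. Qed.

Lemma affine_subst_eq0 (alpha d : F) (p : {poly F}) : d != 0 -> (affine_subst alpha d p == 0) = (p == 0).
Proof.
move=> d0; apply: comp_poly_eq0.
rewrite size_polyDl size_scale // size_polyX // ltnS size_polyC.
by case: eqP.
Qed.

Lemma mono_termE (alpha d : F) (p : {poly F}) i : mono_term alpha d p i = (affine_subst alpha d p)`_i.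
Proof.
rewrite /mono_term /shift_coef /affine_subst.
have -> : d *: 'X + alpha%:P = ('X + alpha%:P) \Po (d *: 'X).
  by rewrite comp_polyD comp_polyX comp_polyC.
rewrite comp_polyA; move: (p \Po ('X + _)) => r.
rewrite coef_comp_poly; under eq_bigr => j _ do rewrite exprZn coefZ coefXn mulrA.
case: (ltnP i (size r)) => szi.
  rewrite (bigD1 (Ordinal szi)) //= eqxx mulr1 big1 ?addr0 // => j ji.
  by rewrite eq_sym -val_eqE /= in ji; rewrite (negPf ji) mulr0.
rewrite nth_default // mul0r big1 // => j _.
by rewrite gtn_eqF ?mulr0 // (leq_trans (ltn_ord j)).
Qed.

Lemma mono_geP (alpha d : F) (p q : {poly F}) e : is_content (affine_subst alpha d q) e ->
  mono_ge U alpha d p q <-> forall i, U ((affine_subst alpha d p)`_i / e).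
Proof.
move=> [e0 Ue [j /nonunitPn[]]]; rewrite mulf_eq0 invr_eq0 negb_or => /andP[qj0 _].
rewrite invf_div => Uj; split=> [[k Hk] i|Up].
  have Hkj := Hk i; rewrite !mono_termE in Hkj.
  case: Hkj => [->|[qk0 Uk]]; first by rewrite mul0r; apply: vr0.
  exact: vr_div_trans Uk (Ue k).
exists j => i; rewrite !mono_termE; right; split=> //.
exact: vr_div_trans (Up i) Uj.
Qed.

(** Independence of the chosen fraction. After cross multiplication, Gauss's lemma gives [c * e'] as
    content of a polynomial whose coefficients are all divisible by [e' * e]; cancelling [e'] leaves
    [c / e] in [U]. *)
Lemma U_mono_frac (alpha d : F) (p q : {poly F}) : d != 0 -> q != 0 ->
  U_mono U alpha d (p%:F / q%:F) <-> mono_ge U alpha d p q.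
Proof.
move=> d0 q0; split=> [[p' [q' [q'0 pqE ge']]]|ge]; last by exists p, q.
have [e eP] : exists e, is_content (affine_subst alpha d q) e.
  by apply: content_exists; rewrite affine_subst_eq0.
have [e' e'P] : exists e, is_content (affine_subst alpha d q') e.
  by apply: content_exists; rewrite affine_subst_eq0.
have /(mono_geP _ e'P) Up' := ge'; apply/(mono_geP _ eP).
have cross : affine_subst alpha d p * affine_subst alpha d q' =
             affine_subst alpha d p' * affine_subst alpha d q.
  rewrite -!affine_substM; congr affine_subst.
  have tf0 (x : {poly F}) : x != 0 -> x%:F != 0 by rewrite tofrac_eq0.
  by move/eqP: pqE; rewrite eqr_div ?tf0 // -!tofracM tofrac_eq => /eqP.
have [->|p0] := eqVneq p 0.
  by move=> i; rewrite affine_subst0 coef0 mul0r; apply: vr0.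
have [c cP] : exists c, is_content (affine_subst alpha d p) c.
  by apply: content_exists; rewrite affine_subst_eq0.
have [c0 Uc _] := cP; have [e0 Ue _] := eP; have [e'0 Ue' _] := e'P.
have := contentM cP e'P; rewrite cross => /content_dvd/(_ (coefM_div_vr Up' Ue)).
rewrite mulf_neq0 // => /(_ isT); rewrite [e' * e]mulrC -mulf_div divff // mulr1 => Uce i.
exact: vr_div_trans (Uc i) Uce.
Qed.

Lemma affine_content_exists (alpha d : F) (p : {poly F}) : d != 0 -> p != 0 ->
  exists e, is_content (affine_subst alpha d p) e.
Proof. by move=> d0 p0; apply: content_exists; rewrite affine_subst_eq0. Qed.

Lemma U_mono_valuation_ring alpha d : d != 0 -> valuation_ring (U_mono U alpha d).
Proof.
move=> d0; split.
- exists 1, 1; split; rewrite ?oner_eq0 // ?tofrac1 ?divr1 //.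
  have c1 : is_content (affine_subst alpha d 1) 1.
    by rewrite affine_substC; apply: contentC; apply: oner_neq0.
  by apply/(mono_geP _ c1); have [_ ? _] := c1.
- move=> _ _ [p [q [q0 -> pq]]] [p' [q' [q'0 -> pq']]].
  have [e eP] := affine_content_exists alpha d0 q0.
  have [e' e'P] := affine_content_exists alpha d0 q'0.
  exists (p * q' - p' * q), (q * q'); split; first by rewrite mulf_neq0.
    rewrite -mulNr addf_div ?tofrac_eq0 // tofracB !tofracM mulNr.
    by [].
  have qq'P : is_content (affine_subst alpha d (q * q')) (e * e').
    by rewrite affine_substM; apply: contentM.
  apply/(mono_geP _ qq'P) => i.
  move/(mono_geP _ eP): pq => pq; move/(mono_geP _ e'P): pq' => pq'.
  have [_ Ue _] := eP; have [_ Ue' _] := e'P.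
  rewrite affine_substB !affine_substM coefB mulrBl; apply: vrB => //.
    exact: coefM_div_vr.
  by rewrite [e * e']mulrC; apply: coefM_div_vr.
- move=> _ _ [p [q [q0 -> pq]]] [p' [q' [q'0 -> pq']]].
  have [e eP] := affine_content_exists alpha d0 q0.
  have [e' e'P] := affine_content_exists alpha d0 q'0.
  exists (p * p'), (q * q'); split; first by rewrite mulf_neq0.
    by rewrite mulf_div !tofracM.
  have qq'P : is_content (affine_subst alpha d (q * q')) (e * e').
    by rewrite affine_substM; apply: contentM.
  apply/(mono_geP _ qq'P).
  move/(mono_geP _ eP): pq => pq; move/(mono_geP _ e'P): pq' => pq'.
  by rewrite affine_substM; apply: coefM_div_vr.
move=> f f0; have [p [q [q0 fE]]] := frac_repr f.
have p0 : p != 0 by apply: contra_neq f0 => p0; rewrite fE p0 tofrac0 mul0r.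
have [c cP] := affine_content_exists alpha d0 p0.
have [e eP] := affine_content_exists alpha d0 q0.
have [c0 Uc _] := cP; have [e0 Ue _] := eP.
case: (pselect (U (c / e))) => [Uce|nUce]; [left|right].
  exists p, q; split=> //; apply/(mono_geP _ eP) => i.
  exact: vr_div_trans (Uc i) Uce.
exists q, p; split=> //; first by rewrite fE invf_div.
apply/(mono_geP _ cP) => i; apply: vr_div_trans (Ue i) _ => //.
by rewrite -invf_div; apply: vrVn => //; rewrite mulf_neq0 ?invr_eq0.
Qed.

Lemma U_mono_const alpha d a : d != 0 -> U_mono U alpha d (constF a) <-> U a.
Proof.
move=> d0; have -> : constF a = (a%:P)%:F / 1%:F by rewrite tofrac1 divr1.
rewrite U_mono_frac ?oner_eq0 //.
have c1 : is_content (affine_subst alpha d 1) 1.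
  by rewrite affine_substC; apply: contentC; apply: oner_neq0.
rewrite (mono_geP _ c1) affine_substC; split=> [/(_ 0%N)|Ua i].
  by rewrite coefC divr1.
by rewrite divr1 coefC; case: ifP => _ //; apply: vr0.
Qed.

(** Test on the quotient of ['X - alpha%:P] by [d]: it has value 0 for the first valuation, and its
    two coefficients for the second one give the two inequalities. *)
Lemma U_mono_sub_inv alpha d alpha' d' : d != 0 -> d' != 0 ->
  (forall f, U_mono U alpha d f -> U_mono U alpha' d' f) ->
  vle U d d' /\ vle U d (alpha - alpha').
Proof.
move=> d0 d'0 sub; have dP : d%:P != 0 :> {poly F} by rewrite polyC_eq0.
have cd b c : is_content (affine_subst b c d%:P) d by rewrite affine_substC; apply: contentC.
have substX b c : affine_subst b c ('X - alpha%:P) = c *: 'X + (b - alpha)%:P.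
  by rewrite affine_substB affine_substC /affine_subst comp_polyX -addrA -polyCB.
have := sub (('X - alpha%:P)%:F / (d%:P)%:F).
rewrite !U_mono_frac // !(mono_geP _ (cd _ _)) !substX subrr addr0 => H.
have {}H i : U ((d' *: 'X + (alpha' - alpha)%:P)`_i / d).
  apply: H => {}i; rewrite coefZ coefX -mulrAC divff // mul1r.
  by case: eqP => _; [apply: vr1|apply: vr0].
rewrite !vleP //; split.
  by have := H 1%N; rewrite coefD coefZ coefX coefC mulr1 addr0.
have := H 0%N; rewrite coefD coefZ coefX coefC mulr0 add0r => /(vrN hU).
by rewrite -mulNr opprB.
Qed.

Lemma comp_affine_vr (p : {poly F}) e u w : (forall i, U (p`_i / e)) -> U u -> U w ->
  forall i, U ((p \Po (u *: 'X + w%:P))`_i / e).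
Proof.
move=> Up Uu Uw i; rewrite coef_comp_poly mulr_suml; apply: vr_sum => // j _.
rewrite mulrAC; apply: vrM => //.
have : forall k, U ((u *: 'X + w%:P)`_k / 1).
  move=> k; rewrite divr1 coefD coefZ coefX coefC; apply: vrD => //.
    by apply: vrM => //; case: eqP => _; [apply: vr1|apply: vr0].
  by case: ifP => _ //; apply: vr0.
elim: (nat_of_ord j) i => [|m IH] i U1.
  by rewrite expr0 coefC; case: ifP => _; [apply: vr1|apply: vr0].
rewrite -[_`_i]divr1 -[1](mulr1 1) exprS; apply: coefM_div_vr => // k.
by rewrite divr1; apply: IH.
Qed.

(** The second affine substitution is the first one followed by an affine substitution with
    coefficients in [U], which preserves divisibility of the coefficients by [e]. *)
Lemma affine_subst_vr alpha d alpha' d' (p : {poly F}) e : d != 0 ->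
  vle U d d' -> vle U d (alpha - alpha') ->
  (forall i, U ((affine_subst alpha d p)`_i / e)) ->
  forall i, U ((affine_subst alpha' d' p)`_i / e).
Proof.
move=> d0; rewrite !vleP // => Udd' Uaa' Up i.
have -> : affine_subst alpha' d' p =
    affine_subst alpha d p \Po ((d' / d) *: 'X + ((alpha' - alpha) / d)%:P).
  rewrite /affine_subst -comp_polyA; congr (p \Po _).
  rewrite comp_polyD comp_polyZ comp_polyX comp_polyC scalerDr scalerA mulrC divfK //.
  by rewrite -addrA scale_polyC mulrC divfK // -polyCD subrK.
apply: comp_affine_vr => //.
by rewrite -opprB mulNr; apply: vrN.
Qed.

Lemma vle_subC d x y : vle U d (x - y) -> vle U d (y - x).
Proof.
case=> [/eqP|[d0 Ud]]; first by rewrite subr_eq0 => /eqP->; left; rewrite subrr.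
by right; split=> //; rewrite -opprB mulNr; apply: vrN.
Qed.

Lemma mono_ge_sub alpha d alpha' d' (p q : {poly F}) : d != 0 -> d' != 0 -> q != 0 ->
  vle U d d' -> vle U d' d -> vle U d (alpha - alpha') ->
  mono_ge U alpha d p q -> mono_ge U alpha' d' p q.
Proof.
move=> d0 d'0 q0 dd' d'd aa'.
have d'a : vle U d' (alpha' - alpha).
  apply: vle_subC; move: dd' d'd aa'; rewrite !vleP // => _ Udd' Uaa'.
  exact: vr_div_trans Uaa' Udd'.
have [e eP] := affine_content_exists alpha d0 q0.
have [e' e'P] := affine_content_exists alpha' d'0 q0.
move/(mono_geP _ eP) => Up; apply/(mono_geP _ e'P) => i.
have [e0 _ _] := eP; have [e'0 Ue' _] := e'P.
(* Changing centre and radius in one direction bounds the coefficients of [p] by [e]; the opposite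
   change, applied to [q], shows that [e / e'] lies in [U]. *)
apply: (vr_div_trans e0); first exact: (affine_subst_vr d0 dd' aa').
apply: content_dvd eP _ e'0.
exact: (affine_subst_vr d'0 d'd d'a).
Qed.

Lemma U_mono_eqP alpha d alpha' d' : d != 0 -> d' != 0 ->
  (forall f, U_mono U alpha d f <-> U_mono U alpha' d' f) <->
  (vle U d d' /\ vle U d' d) /\ vle U d (alpha - alpha').
Proof.
move=> d0 d'0; split=> [eqU|[[dd' d'd] aa'] f].
  have [? ?] := U_mono_sub_inv d0 d'0 (fun f => (eqU f).1).
  by have [? ?] := U_mono_sub_inv d'0 d0 (fun f => (eqU f).2).
split=> -[p [q [q0 -> pq]]]; exists p, q; split=> //.
  exact: mono_ge_sub pq.
apply: mono_ge_sub pq => //; apply: vle_subC.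
move: dd' d'd aa'; rewrite !vleP // => _ Udd' Uaa'.
exact: vr_div_trans Uaa' Udd'.
Qed.

End GaussValuation.

(** * The rational function field *)

Lemma valuation_ring_ext (F : fieldType) (V W : F -> Prop) :
  (forall x, V x <-> W x) -> valuation_ring V -> valuation_ring W.
Proof. by move=> VW; have -> // : W = V; apply/funext => x; apply/propext; rewrite VW. Qed.

Lemma map_polyP_surj (F : fieldType) (sigma : {rmorphism F -> F}) (p : {poly F}) :
  bijective sigma -> exists p', map_poly sigma p' = p.
Proof.
case=> g gK Kg; exists (\poly_(i < size p) g p`_i).
apply/polyP => i; rewrite coef_map coef_poly; case: ltnP => [_ /=|szi]; first exact: Kg.
by rewrite /= rmorph0 nth_default.
Qed.

Section FunctionField.
Variables (Kbar : closedFieldType) (K : {pred Kbar}).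
Hypothesis hK : divring_closed K.
Hypothesis halg : forall x : Kbar, exists p : {poly Kbar},
            [/\ p != 0, p \is a polyOver K & root p x].

Let K' : divringClosed Kbar := HB.pack K (GRing.isDivringClosed.Build Kbar K hK).

Let polyOver_K (p : {poly Kbar}) : (p \is a polyOver K) = (p \is a polyOver K') := erefl.

Definition constF_rmorphism : {rmorphism Kbar -> {fraction {poly Kbar}}} :=
  @FracField.tofrac _ \o polyC.

Lemma monic_annihilator x : exists rs : seq Kbar,
  \prod_(r <- rs) ('X - r%:P) \is a polyOver K /\ x \in rs.
Proof.
have [p [p0 pK px]] := halg x; have [rs pE] := closed_field_poly_normal p.
have l0 : lead_coef p != 0 by rewrite lead_coef_eq0.
exists rs; split.
  have -> : \prod_(r <- rs) ('X - r%:P) = (lead_coef p)^-1 *: p.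
    by rewrite {2}pE scalerA mulVf // scale1r.
  apply: (@polyOverZ _ K') => //; rewrite rpredV.
  exact: (polyOverP (S := K') pK).
by move: px; rewrite pE rootZ // root_prod_XsubC.
Qed.

(** [s] maps the finite set of roots of a polynomial over [K] to itself, so the orbit of [x]
    repeats, and injectivity of the iterates carries the repetition back to [x]. *)
Lemma periodic (s : {rmorphism Kbar -> Kbar}) x : (forall c, c \in K -> s c = c) ->
  exists n, iter n.+1 s x = x.
Proof.
move=> sK; have [rs [rsK xrs]] := monic_annihilator x.
have srs y : y \in rs -> s y \in rs.
  rewrite -!root_prod_XsubC => ry.
  have <- : map_poly s (\prod_(r <- rs) ('X - r%:P)) = \prod_(r <- rs) ('X - r%:P).
    apply/polyP => i; rewrite coef_map /= sK //.
    exact: (polyOverP (S := K') rsK).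
  by rewrite fmorph_root.
have iter_rs i : iter i s x \in rs by elim: i => //= i; apply: srs.
have : looping s x (size rs).
  apply: contraT; rewrite -looping_uniq => u.
  have /(uniq_leq_size u) : {subset traject s x (size rs).+1 <= rs}.
    by move=> y /trajectP[i _ ->].
  by rewrite size_traject ltnn.
case/trajectP => i ltin /esym E; exists (size rs - i).-1.
have inj_it : injective (iter i s) by elim: (i) => //= j IH u v /fmorph_inj/IH.
rewrite prednK ?subn_gt0 //; apply: inj_it.
by rewrite -iterD subnKC // ltnW.
Qed.

Lemma periodic_all (s : {rmorphism Kbar -> Kbar}) (xs : seq Kbar) :
  (forall c, c \in K -> s c = c) -> exists n, forall x, x \in xs -> iter n.+1 s x = x.
Proof.
move=> sK; elim: xs => [|x xs [n IH]]; first by exists 0%N.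
(* The product of the two periods is a common period; the predecessor matches the [n.+1] of the
   statement. *)
have [m xm] := periodic x sK; exists (n.+1 * m.+1).-1%N => y.
rewrite prednK // inE => /orP[/eqP->|/IH yn]; first by rewrite iterM iter_fix.
by rewrite mulnC iterM iter_fix.
Qed.

Lemma fixing_bijective (s : {rmorphism Kbar -> Kbar}) : (forall c, c \in K -> s c = c) ->
  bijective s.
Proof.
move=> sK; have surj y : exists x, s x = y.
  by have [n yn] := periodic y sK; exists (iter n s y).
have [g gP] := choice surj; exists g => // x.
by apply: (fmorph_inj s); rewrite gP.
Qed.

Lemma inKX_const c : c \in K -> inKX K (constF c).
Proof.
move=> cK; exists c%:P, 1; split; rewrite ?oner_eq0 ?tofrac1 ?divr1 //.
  by rewrite polyOver_K polyOverC.
by rewrite polyOver_K rpred1.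
Qed.

Lemma inKX_X : inKX K ('X)%:F.
Proof.
exists 'X, 1; split; rewrite ?oner_eq0 ?tofrac1 ?divr1 //.
  by rewrite polyOver_K polyOverX.
by rewrite polyOver_K rpred1.
Qed.

Lemma inKX_divring_closed : divring_closed (fun f => `[< @inKX Kbar K f >]).
Proof.
split.
- by apply/asboolP; rewrite -(rmorph1 constF_rmorphism); apply: inKX_const; case: hK.
- move=> _ _ /asboolP[p [q [pK qK q0 ->]]] /asboolP[p' [q' [p'K q'K q'0 ->]]].
  apply/asboolP; exists (p * q' - p' * q), (q * q'); split.
  + by rewrite polyOver_K rpredB // rpredM.
  + by rewrite polyOver_K rpredM.
  + by rewrite mulf_neq0.
  + by rewrite -mulNr addf_div ?tofrac_eq0 // tofracB !tofracM mulNr.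
move=> _ _ /asboolP[p [q [pK qK q0 ->]]] /asboolP[p' [q' [p'K q'K q'0 ->]]].
apply/asboolP; have [->|p'0] := eqVneq p' 0.
  exists 0, 1; rewrite oner_eq0 tofrac0 mul0r invr0 mulr0 mul0r; split=> //.
    by rewrite polyOver_K rpred0.
  by rewrite polyOver_K rpred1.
exists (p * q'), (q * p'); split.
+ by rewrite polyOver_K rpredM.
+ by rewrite polyOver_K rpredM.
+ by rewrite mulf_neq0.
+ by rewrite invf_div mulf_div !tofracM.
Qed.

(** An embedding of [Kbar(X)] over [K(X)] fixes ['X] and sends a constant to a root of a polynomial
    with only constant roots. It therefore acts through the coefficients. *)
Lemma dominating_automorphism (A B : {fraction {poly Kbar}} -> Prop) :
  valuation_ring A -> valuation_ring B -> (forall f, inKX K f -> B f -> A f) ->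
  exists s : {rmorphism Kbar -> Kbar}, (forall c, c \in K -> s c = c) /\
    forall p q, B ((map_poly s p)%:F / (map_poly s q)%:F) -> A (p%:F / q%:F).
Proof.
move=> hA hB hBA.
pose F : {pred {fraction {poly Kbar}}} := fun f => `[< inKX K f >].
have splitc c : exists rs : seq Kbar,
    \prod_(r <- map constF_rmorphism rs) ('X - r%:P) \is a polyOver F /\ c \in rs.
  have [rs [rsK crs]] := monic_annihilator c; exists rs; split=> //.
  have -> : \prod_(r <- map constF_rmorphism rs) ('X - r%:P) =
      map_poly constF_rmorphism (\prod_(r <- rs) ('X - r%:P)).
    rewrite rmorph_prod big_map; apply: eq_bigr => r _.
    by rewrite rmorphB /= map_polyX map_polyC.
  apply/allP => _ /(nthP 0)[i _ <-]; rewrite coef_map.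
  apply/asboolP/inKX_const; exact: (polyOverP (S := K') rsK).
have [||| s [sF sBA]] := dominating_embedding hA hB (F := F)
    (Gen := fun f => exists c, f = constF_rmorphism c) inKX_divring_closed.
- by move=> f /asboolP; apply: hBA.
- move=> _ [c ->]; have [rs [rsF crs]] := splitc c.
  by exists (map constF_rmorphism rs); split=> //; apply: map_f.
- move=> E clE FE cE f; have [p [q [_ ->]]] := frac_repr f.
  pose E' : divringClosed {fraction {poly Kbar}} :=
    HB.pack E (GRing.isDivringClosed.Build _ E clE).
  have polyE (r : {poly Kbar}) : r%:F \in E'.
    rewrite -[r]coefK poly_def rmorph_sum; apply: rpred_sum => i _.
    rewrite -mul_polyC rmorphM rmorphXn; apply: rpredM; first by apply: cE; exists r`_i.
    by apply/rpredX/FE/asboolP/inKX_X.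
  exact: (rpred_div (S := E') (polyE p) (polyE q)).
have sconst c : exists c', s (constF_rmorphism c) = constF_rmorphism c'.
  have [rs [rsF crs]] := splitc c.
  have : root (map_poly s (\prod_(r <- map constF_rmorphism rs) ('X - r%:P))) (s (constF_rmorphism c)).
    by rewrite fmorph_root root_prod_XsubC map_f.
  have -> : map_poly s (\prod_(r <- map constF_rmorphism rs) ('X - r%:P)) =
            \prod_(r <- map constF_rmorphism rs) ('X - r%:P).
    apply/polyP => i; rewrite coef_map /= sF //.
    case: (ltnP i (size (\prod_(r <- map constF_rmorphism rs) ('X - r%:P)))) => szi.
      by apply: (allP rsF); apply: mem_nth.
    rewrite nth_default //; apply/asboolP; rewrite -(rmorph0 constF_rmorphism).
    exact/inKX_const/(rpred0 K').
  by rewrite root_prod_XsubC => /mapP[c' _ ->]; exists c'.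
have [sg sgP] := choice sconst.
have sgB : zmod_morphism sg.
  by move=> x y; apply: (fmorph_inj constF_rmorphism); rewrite -sgP !rmorphB -!sgP.
have sgM : monoid_morphism sg.
  split=> [|x y]; apply: (fmorph_inj constF_rmorphism); rewrite -sgP ?rmorph1 //.
  by rewrite !rmorphM -!sgP.
pose sg' : {rmorphism Kbar -> Kbar} := HB.pack sg
  (GRing.isZmodMorphism.Build Kbar Kbar sg sgB)
  (GRing.isMonoidMorphism.Build Kbar Kbar sg sgM).
exists sg'; split=> [c cK|p q].
  by apply: (fmorph_inj constF_rmorphism); rewrite -sgP; apply/sF/asboolP/inKX_const.
have spoly (r : {poly Kbar}) : s r%:F = (map_poly sg' r)%:F.
  elim/poly_ind: r => [|r c IH]; first by rewrite !rmorph0.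
  have -> : map_poly sg' (r * 'X + c%:P) = map_poly sg' r * 'X + (sg c)%:P.
    by rewrite rmorphD rmorphM; congr (_ * _ + _); [exact: map_polyX | exact: map_polyC].
  rewrite !tofracD !tofracM rmorphD rmorphM IH; congr (_ * _ + _).
    by apply/sF/asboolP/inKX_X.
  exact: sgP.
by rewrite -!spoly -fmorph_div; apply: sBA.
Qed.

Lemma frac_image_conjugate (A B : {fraction {poly Kbar}} -> Prop) :
  valuation_ring A -> valuation_ring B -> (forall f, inKX K f -> A f <-> B f) ->
  exists s : {rmorphism Kbar -> Kbar}, in_GK K s /\ forall f, frac_image s A f <-> B f.
Proof.
move=> hA hB hAB.
have [s [sK sBA]] := dominating_automorphism hA hB (fun f fK => (hAB f fK).2).
have [t [tK tAB]] := dominating_automorphism hB hA (fun f fK => (hAB f fK).1).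
have bij_s := fixing_bijective sK.
exists s; split=> //.
have sAB p q : A (p%:F / q%:F) -> B ((map_poly s p)%:F / (map_poly s q)%:F).
  pose rho : {rmorphism Kbar -> Kbar} := t \o s.
  (* [rho] goes from [A] to [A] through [B], so [P] descends. Periodicity identifies [P n.+1] with
     [P 0], hence [P 0] yields [P 1], from which [tAB] gives the claim. *)
  pose P n := A ((iter n (map_poly rho) p)%:F / (iter n (map_poly rho) q)%:F).
  have PS n : P n.+1 -> P n.
    by rewrite /P /= !(map_poly_comp t s) => /tAB/sBA.
  have [n nP] : exists n, forall x, x \in polyseq p ++ polyseq q -> iter n.+1 rho x = x.
    by apply: periodic_all => c cK; rewrite /= sK // tK.
  have iterP (r : {poly Kbar}) : {subset polyseq r <= polyseq p ++ polyseq q} ->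
      iter n.+1 (map_poly rho) r = r.
    move=> sub; apply/polyP => i.
    have -> m : (iter m (map_poly rho) r)`_i = iter m rho r`_i.
      by elim: m => //= m IH; rewrite coef_map IH.
    case: (ltnP i (size r)) => szi; first by apply/nP/sub/mem_nth.
    by rewrite nth_default // iter_fix // rmorph0.
  move=> Apq; have P1 : P 1%N.
    have : P n.+1.
      rewrite /P !iterP // => x xr; rewrite mem_cat xr ?orbT //.
    by elim: n {nP iterP} => // n IH /PS.
  by apply: tAB; rewrite -!map_poly_comp.
move=> f; split=> [[p [q [q0 Apq ->]]]|Bf]; first exact: sAB.
have [p [q [q0 fE]]] := frac_repr f.
have [p' p'E] := map_polyP_surj p bij_s; have [q' q'E] := map_polyP_surj q bij_s.
exists p', q'; split; last by rewrite p'E q'E.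
  by rewrite -(map_poly_eq0 s) q'E.
by apply: sBA; rewrite p'E q'E -fE.
Qed.

End FunctionField.

(** * The decomposition group and its action on monomial valuations *)

Section Decomposition.
Variables (Kbar : closedFieldType) (K : {pred Kbar}).
Hypothesis hK : divring_closed K.
Hypothesis halg : forall x : Kbar, exists p : {poly Kbar},
            [/\ p != 0, p \is a polyOver K & root p x].
Variables (U : Kbar -> Prop) (hU : valuation_ring U).

Lemma in_decompP (s : {rmorphism Kbar -> Kbar}) :
  in_decomp K U s <-> in_GK K s /\ forall x, U (s x) <-> U x.
Proof.
split=> [[sGK sU]|[sGK sU]]; have [bij _] := sGK; split=> //.
  by move=> x; split=> [/sU[z [Uz /(bij_inj bij) <-]]//|Ux]; apply/sU; exists x.
move=> y; split=> [[x [Ux <-]]|Uy]; first exact/sU.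
by case: bij => g gK Kg; exists (g y); rewrite Kg -sU Kg.
Qed.

(* As [s^(n+1) d = d], the conjugates of [s d / d] under the iterates of [s] have product [1]. *)
Lemma decomp_value (s : {rmorphism Kbar -> Kbar}) d : in_decomp K U s -> d != 0 ->
  vle U (s d) d /\ vle U d (s d).
Proof.
move=> /in_decompP[[_ sK] sU] d0; have [n dn] := periodic hK halg d sK.
have it0 k : iter k s d != 0 by elim: k => //= k; rewrite fmorph_eq0.
rewrite !vleP ?fmorph_eq0 //.
(* [P] stands for either direction of the comparison of values. From [P d (s d)], applying [s]
   repeatedly gives a chain from [s d] to [iter n.+1 s d], which is [d]. *)
have step (P : Kbar -> Kbar -> Prop) :
    (forall x, x != 0 -> P x x) -> (forall x y z, y != 0 -> P x y -> P y z -> P x z) ->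
    (forall x y, P x y -> P (s x) (s y)) -> P d (s d) -> P (s d) d.
  move=> Prefl Ptrans Ps Pd; rewrite -{2}dn iterSr.
  elim: (n) => [|m IH]; first by apply: Prefl; rewrite fmorph_eq0.
  apply: Ptrans IH _; first by rewrite -iterSr it0.
  rewrite [X in P _ X]iterSr -!iterSr; elim: m.+1 => //= k; exact: Ps.
case: (pselect (U (s d / d))) => [Usd|nUsd].
  split=> //; apply: (step (fun x y => U (y / x))) => //.
  - by move=> x x0; rewrite divff //; apply: vr1.
  - by move=> x y z y0 Uyx Uzy; apply: vr_div_trans Uzy Uyx.
  - by move=> x y; rewrite -fmorph_div sU.
have Uds : U (d / s d).
  by rewrite -invf_div; apply: vrVn => //; rewrite mulf_neq0 ?invr_eq0 ?fmorph_eq0.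
split=> //; apply: (step (fun x y => U (x / y))) => //.
- by move=> x x0; rewrite divff //; apply: vr1.
- by move=> x y z y0 Uxy Uyz; apply: vr_div_trans Uxy Uyz.
- by move=> x y; rewrite -fmorph_div sU.
Qed.

Lemma mono_term_map (s : {rmorphism Kbar -> Kbar}) alpha d p i :
  mono_term (s alpha) (s d) (map_poly s p) i = s (mono_term alpha d p i).
Proof.
rewrite /mono_term /shift_coef rmorphM rmorphXn -coef_map map_comp_poly.
by rewrite rmorphD /= map_polyX map_polyC.
Qed.

Lemma mono_ge_map (s : {rmorphism Kbar -> Kbar}) alpha d p q : in_decomp K U s ->
  mono_ge U (s alpha) (s d) (map_poly s p) (map_poly s q) <-> mono_ge U alpha d p q.
Proof.
move=> /in_decompP[_ sU].
have vle_s x y : vle U (s x) (s y) <-> vle U x y.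
  rewrite /vle fmorph_eq0 -fmorph_div sU.
  by split=> -[/eqP|?]; [rewrite fmorph_eq0 => /eqP; left|right|move/eqP->; rewrite rmorph0; left|right].
by split=> -[j Hj]; exists j => i; have := Hj i; rewrite !mono_term_map vle_s.
Qed.

(** Transport of structure moves both parameters, giving [s alpha] and [s d]; since [s d] and [d]
    have the same value, [d] may be put back. *)
Lemma frac_image_U_mono (s : {rmorphism Kbar -> Kbar}) alpha d : d != 0 -> in_decomp K U s ->
  forall f, frac_image s (U_mono U alpha d) f <-> U_mono U (s alpha) d f.
Proof.
move=> d0 sD f; have [[[bij _] _] [sdd dsd]] := (sD, decomp_value sD d0).
have sd0 : s d != 0 by rewrite fmorph_eq0.
have eqU : forall f, U_mono U (s alpha) (s d) f <-> U_mono U (s alpha) d f.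
  by apply/U_mono_eqP => //; rewrite subrr; split=> //; left.
rewrite -eqU; split=> [[p [q [q0 pq ->]]]|[p [q [q0 -> pq]]]].
  exists (map_poly s p), (map_poly s q); split; rewrite ?map_poly_eq0 //.
  by apply/(mono_ge_map _ _ _ _ sD)/(U_mono_frac hU).
have [p' p'E] := map_polyP_surj p bij; have [q' q'E] := map_polyP_surj q bij.
have q'0 : q' != 0 by rewrite -(map_poly_eq0 s) q'E.
exists p', q'; rewrite p'E q'E; split=> //; apply/(U_mono_frac hU) => //.
by apply/(mono_ge_map _ _ _ _ sD); rewrite p'E q'E.
Qed.

Lemma frac_image_map (s : {rmorphism Kbar -> Kbar}) W p q : q != 0 ->
  frac_image s W ((map_poly s p)%:F / (map_poly s q)%:F) <-> W (p%:F / q%:F).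
Proof.
move=> q0; split=> [[a [b [b0 Wab /eqP]]]|Wpq]; last by exists p, q.
rewrite eqr_div ?tofrac_eq0 ?map_poly_eq0 // -!tofracM tofrac_eq -!rmorphM.
rewrite (inj_eq (map_inj_poly (fmorph_inj s) (rmorph0 s))) -tofrac_eq !tofracM.
by rewrite -eqr_div ?tofrac_eq0 // => /eqP->.
Qed.

Lemma frac_image_KX (s : {rmorphism Kbar -> Kbar}) W f : in_GK K s -> inKX K f ->
  frac_image s W f <-> W f.
Proof.
case=> _ sK [p [q [pK qK q0 ->]]].
have sid (r : {poly Kbar}) : r \is a polyOver K -> map_poly s r = r.
  move=> rK; apply/polyP => i; rewrite coef_map.
  case: (ltnP i (size r)) => szi; first by apply: sK; apply: (allP rK); apply: mem_nth.
  by rewrite nth_default //= rmorph0.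
by rewrite -{1}(sid p pK) -{1}(sid q qK); apply: frac_image_map.
Qed.

(** Both rings restrict to [U] on the constants, so reading the conjugacy there shows that the
    automorphism preserves [U]. *)
Lemma conjugate_over_U (A B : {fraction {poly Kbar}} -> Prop) :
  valuation_ring A -> valuation_ring B ->
  (forall a, A (constF a) <-> U a) -> (forall a, B (constF a) <-> U a) ->
  (forall f, inKX K f -> A f <-> B f) ->
  exists s : {rmorphism Kbar -> Kbar}, in_decomp K U s /\ forall f, frac_image s A f <-> B f.
Proof.
move=> hA hB AU BU AB; have [s [sGK sAB]] := frac_image_conjugate hK halg hA hB AB.
exists s; split=> //; apply/in_decompP; split=> // x.
have constE (a : Kbar) : constF a = (a%:P)%:F / 1%:F by rewrite tofrac1 divr1.
have imE : constF (s x) = (map_poly s x%:P)%:F / (map_poly s 1)%:F.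
  by rewrite map_polyC rmorph1 constE.
by rewrite -BU -sAB -AU imE constE; apply: frac_image_map; apply: oner_neq0.
Qed.

End Decomposition.

(** * Conjugacy of monomial valuations with the same trace on [K(X)] *)

Theorem mainTheorem1
  (Kbar : closedFieldType) (K : {pred Kbar})
  (hK : divring_closed K)
  (halg : forall x : Kbar, exists p : {poly Kbar},
            [/\ p != 0, p \is a polyOver K & root p x])
  (U : Kbar -> Prop) (hU : valuation_ring U)
  (alpha d alpha' d' : Kbar) (hd : d != 0) (hd' : d' != 0) :
  (* (1) <-> (2) *)
  ((forall f, inKX K f -> (U_mono U alpha d f <-> U_mono U alpha' d' f)) <->
   (exists sigma : {rmorphism Kbar -> Kbar}, in_decomp K U sigma /\
      forall f, frac_image sigma (U_mono U alpha d) f <-> U_mono U alpha' d' f))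
  /\
  (* (2) <-> (3) *)
  ((exists sigma : {rmorphism Kbar -> Kbar}, in_decomp K U sigma /\
      forall f, frac_image sigma (U_mono U alpha d) f <-> U_mono U alpha' d' f) <->
   ((vle U d d' /\ vle U d' d) /\
    exists sigma : {rmorphism Kbar -> Kbar}, in_decomp K U sigma /\
      vle U d (sigma alpha - alpha')))
  /\
  (* extensions of W = U_{alpha,delta} \cap K(X) to Kbar(X) lying above U *)
  (forall W' : {fraction {poly Kbar}} -> Prop,
     (valuation_ring W' /\
      (forall f, (W' f /\ inKX K f) <-> (U_mono U alpha d f /\ inKX K f)) /\
      (forall a : Kbar, W' (constF a) <-> U a))
     <->
     (exists sigma : {rmorphism Kbar -> Kbar}, in_decomp K U sigma /\
        forall f, W' f <-> U_mono U (sigma alpha) d f)).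
Proof.
have hA := U_mono_valuation_ring hU alpha hd.
have im s (sD : in_decomp K U s) := frac_image_U_mono hK halg hU alpha hd sD.
(* Conditions (2) and (3) match for each fixed automorphism, since the image of the first ring is
   the monomial ring at [s alpha], [d]. *)
have eq23 s : in_decomp K U s ->
    (forall f, frac_image s (U_mono U alpha d) f <-> U_mono U alpha' d' f) <->
    (vle U d d' /\ vle U d' d) /\ vle U d (s alpha - alpha').
  move=> sD; rewrite -(U_mono_eqP hU (s alpha) alpha' hd hd').
  by split=> H f; have := H f; rewrite (im s sD).
split; [|split].
- split=> [eqKX|[s [sD sE]] f fK].
    apply: (conjugate_over_U hK halg hA (U_mono_valuation_ring hU alpha' hd')) => //.
      by move=> a; apply: (U_mono_const hU).
    by move=> a; apply: (U_mono_const hU).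
  (* An automorphism over [K] fixes [K(X)] pointwise, so a ring and its image have the same trace
     there. *)
  have [sGK _] := sD; rewrite -sE; apply: iff_sym; exact: (frac_image_KX _ sGK fK).
- split=> [[s [sD /(eq23 s sD)[dd' sa]]]|[dd' [s [sD sa]]]]; first by split=> //; exists s.
  by exists s; split=> //; apply/eq23.
move=> W'; split=> [[hW' [WKX WU]]|[s [sD sW']]].
  (* An arbitrary extension above [U] is compared with the given monomial ring: conjugacy makes it
     an image of that ring, hence monomial. *)
  have [||s [sD sE]] := conjugate_over_U hK halg hA hW' _ WU.
  - by move=> a; apply: (U_mono_const hU).
  - by move=> f fK; have := WKX f; tauto.
  by exists s; split=> // f; rewrite -sE; apply: im.
split; [|split].
- exact: valuation_ring_ext (fun f => iff_sym (sW' f)) (U_mono_valuation_ring hU (s alpha) hd).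
- move=> f; rewrite sW' -(im s sD).
  have [sGK _] := sD.
  by split=> -[Wf fK]; split=> //; move: Wf; rewrite (frac_image_KX _ sGK fK).
by move=> a; rewrite sW'; apply: (U_mono_const hU).
Qed.
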